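(* Let $n,m\geq 1$ and let $S_1,\dots,S_{n+m}$ be real random variables which are i.i.d. and have almost surely no ties (i.e. $S_i\neq S_j$ for all $i\neq j$ a.s.). Let $F(s)=\mathbb{P}(S_1\leq s)$, $s\in\mathbb{R}$, be their common c.d.f. Define the conformal $p$-values $$p_i=\frac{1}{n+1}\Big(1+\sum_{j=1}^n \mathbf{1}\{S_j\geq S_{n+i}\}\Big),\quad i\in\{1,\dots,m\}.$$ Set $U=(U_1,\dots,U_n)=(1-F(S_1),\dots,1-F(S_n))$. Then, conditionally on $\mathcal{D}_{\mathrm{cal}}=(S_1,\dots,S_n)$, the $p$-values $p_1,\dots,p_m$ are i.i.d. with common distribution $P^U$. In addition, $U_1,\dots,U_n$ are i.i.d. $\mathrm{Unif}[0,1]$.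
   Context: For a fixed vector $U=(U_1,\dots,U_n)\in[0,1]^n$, let $0=U_{(0)}\leq U_{(1)}\leq\dots\leq U_{(n)}\leq U_{(n+1)}=1$, where $U_{(1)}\leq\dots\leq U_{(n)}$ are the increasingly ordered values of $U_1,\dots,U_n$. $P^U$ denotes the discrete distribution on $\{\ell/(n+1):\ell\in\{1,\dots,n+1\}\}$ with $P^U(\{\ell/(n+1)\})=U_{(\ell)}-U_{(\ell-1)}$, $\ell\in\{1,\dots,n+1\}$; equivalently its c.d.f. is $F^U(x)=U_{(\lfloor (n+1)x\rfloor)}$, $x\in[0,1]$. *)

(* Defs.v *)
From HB Require Import structures.
From mathcomp Require Import all_boot all_order all_algebra.
From mathcomp Require Import all_classical all_reals all_analysis.
Set Implicit Arguments. Unset Strict Implicit. Unset Printing Implicit Defensive.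
Import Order.TTheory GRing.Theory Num.Theory.
Local Open Scope classical_set_scope.
Local Open Scope ring_scope.

(* Mutual independence of a finite family of real random variables:
   the product rule for every family of Borel sets (taking B i = setT
   recovers the rule for every subfamily). *)
Definition indep_family d (T : measurableType d) (R : realType)
  (P : probability T R) (k : nat) (X : 'I_k -> T -> R) : Prop :=
  forall B : 'I_k -> set R, (forall i, measurable (B i)) ->
    P (\bigcap_(i in [set: 'I_k]) (X i @^-1` B i)) =
    (\prod_(i < k) P (X i @^-1` B i))%E.

Definition order_stat (R : realType) (n : nat) (u : nat -> R) (l : nat) : R :=
  if l == 0%N then 0
  else if (n < l)%N then 1
  else nth 0 (sort <=%R [seq u j | j <- iota 0 n]) l.-1.

(* P^U({l/(n+1)}) = U_(l) - U_(l-1) for l in {1,...,n+1}; 0 elsewhere. *)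
Definition PU (R : realType) (n : nat) (u : nat -> R) (l : nat) : R :=
  if (1 <= l <= n.+1)%N then order_stat n u l - order_stat n u l.-1 else 0.

(* conformal p-value of test point i (0-based: calibration scores are
   S 0, ..., S (n-1), test scores S n, ..., S (n+m-1)). *)
Definition conf_pvalue d (T : measurableType d) (R : realType)
  (n : nat) (S : nat -> T -> R) (i : nat) (t : T) : R :=
  (1 + \sum_(j < n) (((S (n + i)%N t <= S j t)%R : bool)%:R)) / n.+1%:R.

Definition score_cdf d (T : measurableType d) (R : realType)
  (P : probability T R) (X : T -> R) (s : R) : R :=
  fine (P [set t | X t <= s]).

Definition calib_events d (T : measurableType d) (R : realType)
  (n : nat) (S : nat -> T -> R) : set (set T) :=
  <<s [set A | exists2 j, (j < n)%N &
         exists2 B : set R, measurable B & A = S j @^-1` B] >>.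

(* Main.v *)
(** Let [mu] be the common law of the scores. For fixed calibration scores
    [s_0, ..., s_(n-1)], the event that at least [k] of them are [>= x] is the
    half-line below the [k]-th largest one, so its [mu]-measure is
    [1 - U_(k)]; taking differences, a single test point has p-value
    [l / (n + 1)] with probability exactly [PU l].

    The score [S k] is independent of the sigma-algebra generated by
    [S 0, ..., S (k - 1)], since both are controlled by the pi-system of finite
    intersections of preimages. Hence Fubini applies to functions of the past
    and of [S k], and the test points are integrated out one at a time, starting
    from the last.

    Finally, the absence of ties forces [mu] to have no atoms, because
    [P (S 0 = S 1 = x) = mu {x} ^ 2], so that the c.d.f. is continuous and
    [1 - F (S i)] is uniform. *)

Require Import Defs.
From HB Require Import structures.
From mathcomp Require Import all_boot all_order all_algebra.
From mathcomp Require Import all_classical all_reals all_analysis.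
From mathcomp Require Import measurable_realfun.
Import Order.TTheory GRing.Theory Num.Theory.
Local Open Scope classical_set_scope.
Local Open Scope ring_scope.

Set Implicit Arguments.
Unset Strict Implicit.
Unset Printing Implicit Defensive.

(** * Tonelli's theorem for independent random elements *)

(** Independence says that the joint law of [(Y, X)] and the product of the two laws agree on
    rectangles; they are therefore equal, and Tonelli applies to the product. *)
Lemma ge0_integral_indep d d1 d2 (T : measurableType d)
    (T1 : measurableType d1) (T2 : measurableType d2) (R : realType)
    (P : probability T R) (Y : {mfun T >-> T1}) (X : {mfun T >-> T2})
    (f : T1 * T2 -> \bar R) :
  (forall A C, measurable A -> measurable C ->
    P (Y @^-1` A `&` X @^-1` C) = (P (Y @^-1` A) * P (X @^-1` C))%E) ->
  measurable_fun setT f -> (forall z, (0 <= f z)%E) ->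
  (\int[P]_t f (Y t, X t) =
   \int[P]_t \int[distribution P X]_x f (Y t, x))%E.
Proof.
move=> indep mf f0.
have mYX : measurable_fun setT (fun t => (Y t, X t)).
  exact/measurable_fun_pair.
pose Z : {mfun T >-> (T1 * T2)%type} := mfun_Sub (mem_set mYX).
have prodE A : measurable A ->
    (distribution P Y \x distribution P X)%E A = distribution P Z A.
  apply: product_measure_unique => A1 A2 mA1 mA2.
  rewrite /distribution /pushforward -indep//; congr (P _).
transitivity (\int[distribution P Z]_z f z)%E.
  by rewrite ge0_integral_distribution.
transitivity (\int[(distribution P Y \x distribution P X)%E]_z f z)%E.
  by apply: eq_measure_integral => A mA _; exact/esym/prodE.
rewrite fubini_tonelli1//.
rewrite ge0_integral_distribution//.
  exact: measurable_fun_fubini_tonelli_F.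
by move=> y; exact: integral_ge0.
Qed.

(** * Counting scores above a threshold, and order statistics *)

(** In a nonincreasing list the entries [>= x] form an initial segment, so its length exceeds [k]
    exactly when position [k], counted from 0, belongs to it. *)
Lemma count_ge_sorted d (T : orderType d) (s : seq T) (x : T) (k : nat) x0 :
  sorted >=%O s -> (k < size s)%N ->
  (k < count (fun y => (x <= y)%O) s)%N = (x <= nth x0 s k)%O.
Proof.
elim: s k => [//|a s IH] k /= pa ks.
have all_le : all (fun y => (y <= a)%O) s.
  move: pa; rewrite path_sortedE => [/andP[]//|y z t yz zt].
  exact: le_trans zt yz.
have [xa|ax] := leP x a.
  case: k ks => [|k] ks //=.
  by rewrite add1n ltnS IH// (path_sorted pa).
have c0 : count (fun y => (x <= y)%O) s = 0%N.
  apply/eqP; rewrite -leqn0 leqNgt -has_count -all_predC.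
  apply: sub_all all_le => y /= ya.
  by rewrite -ltNge; exact: le_lt_trans ax.
rewrite c0 addn0 ltn0; apply/esym/negbTE; rewrite -ltNge.
case: k ks => [//|k] /= ks; apply: le_lt_trans ax.
by move/allP : all_le; apply; exact: mem_nth.
Qed.

Lemma order_stat_map (R : realType) (n : nat) (phi : R -> R) (s : nat -> R)
    (k : nat) :
  {homo phi : x y / x <= y >-> y <= x} -> (k < n)%N ->
  order_stat n (phi \o s) k.+1 =
  phi (nth 0 (sort >=%R [seq s j | j <- iota 0 n]) k).
Proof.
move=> phiN kn; rewrite /order_stat/= ltnNge kn/=.
rewrite -(nth_map _ 0) ?size_sort ?size_map ?size_iota//; congr nth.
have tot : total (>=%R : rel R) by move=> x y; exact: le_total.
apply: (@sorted_eq _ <=%R) => //.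
- exact: le_trans.
- exact: le_anti.
- by apply: sort_sorted => x y; exact: le_total.
- apply: (homo_sorted (e := >=%R)); first by move=> x y /phiN.
  exact: sort_sorted.
- rewrite perm_sort map_comp; apply: perm_map.
  by rewrite perm_sym perm_sort.
Qed.

(** The p-value of a test score [x] is [(geq_count n s x).+1 / n.+1]; working with the integer
    numerator turns equalities of p-values into equalities in [nat]. *)
Definition geq_count (R : realType) (n : nat) (s : nat -> R) (x : R) : nat :=
  \sum_(j < n) (x <= s j)%R.

Lemma geq_countE (R : realType) (n : nat) (s : nat -> R) (x : R) :
  geq_count n s x =
  count (fun y => x <= y) (sort >=%R [seq s j | j <- iota 0 n]).
Proof.
have /permP -> : perm_eq (sort >=%R [seq s j | j <- iota 0 n])
    [seq s j | j <- iota 0 n].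
  by rewrite perm_sort.
rewrite count_map -sum1_count [RHS]big_mkcond/= -{2}[n]subn0.
rewrite -/(index_iota 0 n) big_mkord; apply: eq_bigr => j _ /=.
by case: (x <= s j).
Qed.

Lemma geq_count_le (R : realType) (n : nat) (s : nat -> R) (x : R) :
  (geq_count n s x <= n)%N.
Proof.
rewrite geq_countE (leq_trans (count_size _ _))//.
by rewrite size_sort size_map size_iota.
Qed.

Lemma geq_count_gtE (R : realType) (n : nat) (s : nat -> R) (k : nat) :
  (k < n)%N -> [set x | (k < geq_count n s x)%N] =
  `]-oo, nth 0 (sort >=%R [seq s j | j <- iota 0 n]) k]%classic.
Proof.
move=> kn; apply/seteqP; split=> x /=; rewrite in_itv/= geq_countE;
  rewrite (count_ge_sorted _ 0) ?size_sort ?size_map ?size_iota//;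
  by apply: sort_sorted => u v; exact: le_total.
Qed.

(** At [k = 0] the event is full and at [k = n.+1] it is empty, which is what the conventions U_(0)
    = 0 and U_(n+1) = 1 encode. *)
Lemma prob_geq_count_ge (R : realType) (mu : probability R R)
    (n : nat) (s : nat -> R) (k : nat) : (k <= n.+1)%N ->
  mu [set x | (k <= geq_count n s x)%N] =
  (1 - order_stat n (fun j => 1 - fine (mu `]-oo, s j]%classic)) k)%:E.
Proof.
case: k => [_|k].
  by rewrite set_true /order_stat/= subr0 probability_setT.
rewrite ltnS leq_eqVlt => /predU1P[->|kn].
  rewrite /order_stat/= ltnSn subrr (_ : [set x | _] = set0) ?measure0//.
  by apply/seteqP; split=> // x /=; rewrite ltnNge geq_count_le.
rewrite (@order_stat_map _ n (fun x => 1 - fine (mu `]-oo, x]%classic)) s)//.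
  rewrite subKr fineK ?fin_num_measure//; congr (mu _).
  exact: geq_count_gtE.
move=> x y xy; rewrite lerB// fine_le ?fin_num_measure// le_measure ?inE//.
exact: subset_itvl.
Qed.

Lemma measurable_geq_count_ge (R : realType) (n : nat) (s : nat -> R) (k : nat) :
  measurable [set x | (k <= geq_count n s x)%N].
Proof.
case: k => [|k]; first by rewrite set_true.
have [kn|nk] := ltnP k n; last first.
  rewrite (_ : [set x | _] = set0)//; apply/seteqP; split=> // x /=.
  by rewrite ltnNge (leq_trans (geq_count_le _ _ _)).
by rewrite geq_count_gtE.
Qed.

Lemma geq_count_eqE (R : realType) (n : nat) (s : nat -> R) (l : nat) :
  [set x | (geq_count n s x).+1 = l.+1] =
  [set x | (l <= geq_count n s x)%N] `\` [set x | (l < geq_count n s x)%N].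
Proof.
apply/seteqP; split=> x /=; first by case=> ->; rewrite leqnn ltnn; split.
case=> lc /negP; rewrite -leqNgt => cl.
by congr _.+1; apply/eqP; rewrite eqn_leq lc cl.
Qed.

Lemma measurable_geq_count_eq (R : realType) (n : nat) (s : nat -> R) (l : nat) :
  measurable [set x | (geq_count n s x).+1 = l].
Proof.
case: l => [|l].
  by rewrite (_ : [set x | _] = set0)//; apply/seteqP; split.
by rewrite geq_count_eqE; apply: measurableD; exact: measurable_geq_count_ge.
Qed.

Lemma prob_geq_countE (R : realType) (mu : probability R R)
    (n : nat) (s : nat -> R) (l : nat) :
  mu [set x | (geq_count n s x).+1 = l] =
  (PU n (fun j => 1 - fine (mu `]-oo, s j]%classic)) l)%:E.
Proof.
rewrite /PU; case: ifPn => [/andP[l0 ln]|lN]; last first.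
  rewrite (_ : [set x | _] = set0) ?measure0//; apply/seteqP; split=> // x /= xl.
  by move: lN; rewrite -xl /= ltnS geq_count_le.
case: l l0 ln => // l _ ln.
rewrite geq_count_eqE.
rewrite measureD; last 3 first.
- exact: measurable_geq_count_ge.
- exact: measurable_geq_count_ge.
- by rewrite -ge0_fin_numE// fin_num_measure//; exact: measurable_geq_count_ge.
rewrite setIidr; last by move=> x /= /ltnW.
pose u j := 1 - fine (mu `]-oo, s j]%classic).
transitivity ((1 - order_stat n u l)%:E - (1 - order_stat n u l.+1)%:E)%E.
  by congr (_ - _)%E; apply: prob_geq_count_ge => //; exact: ltnW.
by rewrite -EFinB/=; congr (_%:E); rewrite opprB addrC addrA subrK.
Qed.

(** * Independence of a score from the sigma-algebra of the preceding ones *)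

Section independence.
Context d (T : measurableType d) (R : realType) (P : probability T R).
Variables (S : nat -> T -> R) (N : nat).
Hypothesis mS : forall i, (i < N)%N -> measurable_fun setT (S i).
Hypothesis indepS : indep_family P (fun i : 'I_N => S i).

Lemma indep_family_prefix k (B : nat -> set R) : (k <= N)%N ->
  (forall i, measurable (B i)) ->
  P (\bigcap_(i < k) S i @^-1` B i) = (\prod_(i < k) P (S i @^-1` B i))%E.
Proof.
move=> kN mB; pose B' i := if (i < k)%N then B i else setT.
transitivity (P (\bigcap_(i in [set: 'I_N]) (S i @^-1` B' i))).
  congr (P _); apply/seteqP; split=> t /= h i.
    by move=> _; rewrite /B'/=; case: ifPn => // ik; exact: h.
  move=> /= ik; have := h (Ordinal (leq_trans ik kN)) I.
  by rewrite /B'/= ik.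
rewrite (indepS (B := fun i : 'I_N => B' i)); last first.
  by move=> i; rewrite /B'; case: ifP.
rewrite (big_ord_widen N (fun i => P (S i @^-1` B i)) kN) [RHS]big_mkcond/=.
apply: eq_bigr => i _; rewrite /B'; case: ifP => // _.
by rewrite preimage_setT probability_setT.
Qed.

(** For [k = n] this generates [calib_events n S]; a larger [k] adds the first test scores to the
    past. *)
Definition calib_gen k : set (set T) :=
  [set A | exists2 j, (j < k)%N &
     exists2 B : set R, measurable B & A = S j @^-1` B].

Lemma calib_gen_measurable k : (k <= N)%N -> <<s calib_gen k >> `<=` measurable.
Proof.
move=> kN; apply: smallest_sub; first exact: sigma_algebra_measurable.
move=> _ [j jk [B mB ->]]; rewrite -[X in measurable X]setTI.
exact: (mS (leq_trans jk kN)).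
Qed.

(** As functions of [A], both sides are finite measures: [P] restricted to [S k @^-1]
    C[, and]P[scaled by the constant]P (S k @^-1[C)]. They agree on the pi-system [G] of cylinders,
    hence on the sigma-algebra it generates. *)
Lemma indep_calib k (A : set T) (C : set R) : (k < N)%N ->
  <<s calib_gen k >> A -> measurable C ->
  P (A `&` S k @^-1` C) = (P A * P (S k @^-1` C))%E.
Proof.
move=> kN sA mC.
pose G : set (set T) := [set A | exists2 B : nat -> set R,
  (forall i, measurable (B i)) & A = \bigcap_(i < k) S i @^-1` B i].
have mSB i B : (i <= k)%N -> measurable B -> measurable (S i @^-1` B).
  move=> ik mB; rewrite -[X in measurable X]setTI.
  exact: (mS (leq_ltn_trans ik kN)).
have GT : G setT.
  by exists (fun=> setT) => //; apply/seteqP; split.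
have Gm : G `<=` measurable.
  move=> _ [B mB ->]; apply: bigcap_measurableType => i /= ik.
  exact: mSB (ltnW ik) _.
have GI : setI_closed G.
  move=> _ _ [B mB ->] [B' mB' ->]; exists (fun i => B i `&` B' i).
    by move=> i; exact: measurableI.
  by rewrite -bigcapI; apply: eq_bigcapr => i _; rewrite preimage_setI.
have {sA} sA : <<s G >> A.
  apply: sub_sigma_algebra2 sA => _ [j jk [B mB ->]].
  exists (fun i => if i == j then B else setT) => [i|]; first by case: ifP.
  apply/seteqP; split=> t /=.
    by move=> Bt i _ /=; case: eqP => // ->.
  by move/(_ j jk) => /=; rewrite eqxx.
have mD := mSB k C (leqnn k) mC.
pose c : {nonneg R} := NngNum (fine_ge0 (measure_ge0 P (S k @^-1` C))).
have scaleE A' : (P A' * P (S k @^-1` C) = mscale c P A')%E.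
  by rewrite /mscale/= fineK ?fin_num_measure// muleC.
rewrite scaleE; change (mrestr P mD A = mscale c P A).
apply: (@g_sigma_algebra_measure_unique _ _ _ G Gm (fun=> setT)) => //.
- by apply/seteqP; split => // t _; exists 0%N.
- move=> _ [B mB ->]; apply: etrans (scaleE _).
  change (P ((\bigcap_(i < k) S i @^-1` B i) `&` S k @^-1` C) =
    P (\bigcap_(i < k) S i @^-1` B i) * P (S k @^-1` C))%E.
  (* Placing [C] at index [k] makes the intersection a cylinder over [k.+1] scores, to which the
     product rule applies. *)
  pose B' i := if (i < k)%N then B i else C.
  have mB' i : measurable (B' i) by rewrite /B'; case: ifP.
  rewrite indep_family_prefix ?(ltnW kN)//.
  have := indep_family_prefix kN mB'; rewrite big_ord_recr/= {3}/B' ltnn => h.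
  transitivity (P (\bigcap_(i < k.+1) S i @^-1` B' i)).
    congr (P _); apply/seteqP; split=> t /=.
      move=> [h1 h2] i /=; rewrite ltnS leq_eqVlt /B' => /predU1P[->|ik].
        by rewrite ltnn.
      by rewrite ik; exact: h1.
    move=> h1; split=> [i /= ik|].
      by have := h1 i (ltnW ik); rewrite /B'/= ik.
    by have := h1 k (ltnSn k); rewrite /B'/= ltnn.
  rewrite h; congr (_ * _)%E; apply: eq_bigr => i _.
  by rewrite /B' ltn_ord.
- move=> _; change (P (setT `&` S k @^-1` C) < +oo)%E.
  by rewrite setTI -ge0_fin_numE// fin_num_measure.
Qed.

End independence.

(** * The probability integral transform *)

Section probability_integral_transform.
Context d (T : measurableType d) (R : realType) (P : probability T R).
Variable X : {RV P >-> R}.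
Local Notation F := (score_cdf P X).

Lemma score_cdfE r : (F r)%:E = cdf X r.
Proof.
rewrite /score_cdf -[X in fine (P X)]preimage_itvNyc fineK//.
by rewrite fin_num_measure//; exact: measurable_funPTI.
Qed.

Lemma score_cdf_nondecreasing : {homo F : x y / x <= y}.
Proof. by move=> x y xy; rewrite -lee_fin !score_cdfE cdf_nondecreasing. Qed.

Lemma score_cdf_ge0 r : 0 <= F r.
Proof. by rewrite -lee_fin score_cdfE cdf_ge0. Qed.

Lemma score_cdf_le1 r : F r <= 1.
Proof. by rewrite -lee_fin score_cdfE cdf_le1. Qed.

Hypothesis atomless : forall x, P (X @^-1` [set x]) = 0%E.

(** Let [s] be the supremum of the sublevel set [A]. Right continuity gives [y <= F s], and left
    continuity, which comes from the absence of atoms, gives [F s <= y]. The event is then [X <= s],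
    of probability [F s = y]. *)
Lemma prob_score_cdf_le y : 0 <= y < 1 -> P [set t | F (X t) <= y] = y%:E.
Proof.
move=> /andP[y0 y1]; pose A := [set r | F r <= y].
have [b yb] : exists b, y < F b.
  apply: contrapT => /forallNP h.
  have : (1 <= y%:E)%E.
    apply: (cvge_to_le (cvg_cdfy1 X)); apply: nearW => r.
    by rewrite -score_cdfE lee_fin leNgt; apply/negP/h.
  by rewrite lee_fin leNgt y1.
(* If [A] is empty, [F] stays above [y] although it tends to 0 at minus infinity, so [y = 0]. *)
have [A0|/set0P[a Aa]] := eqVneq A set0.
  have AN r : y < F r.
    by rewrite ltNge; apply/negP => rA; have : A r by []; rewrite A0.
  have : (y%:E <= 0)%E.
    apply: (cvge_to_ge (cvg_cdfNy0 X)); apply: nearW => r.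
    by rewrite -score_cdfE lee_fin ltW.
  rewrite lee_fin => y0'; have -> : y = 0 by apply/eqP; rewrite eq_le y0 y0'.
  rewrite (_ : [set t | _] = set0) ?measure0//; apply/seteqP; split=> // t /=.
  by rewrite leNgt (le_lt_trans y0 (AN _)).
have ubA : has_ubound A.
  exists b => r /= Ar; rewrite leNgt; apply/negP => br.
  by have := le_trans (score_cdf_nondecreasing (ltW br)) Ar; rewrite leNgt yb.
have supA : has_sup A by split => //; exists a.
pose s := sup A.
have A_lt r : r < s -> F r <= y.
  rewrite -subr_gt0 => sr; have [e Ae] := sup_adherent sr supA.
  rewrite -/s subKr => re; apply: le_trans Ae.
  exact/score_cdf_nondecreasing/ltW.
have Fs_ge : y <= F s.
  rewrite -lee_fin score_cdfE.
  apply: (cvge_to_ge (@cdf_right_continuous _ _ _ _ X s)); near=> r.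
  rewrite -score_cdfE lee_fin leNgt; apply/negP => /ltW Ar.
  have : s < r by near: r; exact: nbhs_right_gt.
  by rewrite ltNge ub_le_sup.
have Fs_le : F s <= y.
  (* Left continuity at [s]: these events increase to [X < s], each has probability at most [y] by
     [A_lt], and the atom at [s] contributes nothing. *)
  have ltE : [set t | X t < s] = \bigcup_k (X @^-1` `]-oo, (s - k.+1%:R^-1)%R]).
    apply/seteqP; split=> t /=.
      rewrite -subr_gt0 => /ltr_add_invr[k]; rewrite add0r => h.
      by exists k => //=; rewrite in_itv/= lerBrDr -lerBrDl ltW.
    move=> [k _ /=]; rewrite in_itv/= => /le_lt_trans; apply.
    by rewrite ltrBlDr ltrDl.
  have -> : F s = fine (P [set t | X t < s]).
    rewrite /score_cdf.
    have -> : [set t | X t <= s] = [set t | X t < s] `|` X @^-1` [set s].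
      apply/seteqP; split=> t /=.
        by rewrite le_eqVlt => /predU1P[|]; [right|left].
      by case=> [/ltW//|->].
    transitivity (fine (P [set t | (X t < s)%R] + P (X @^-1` [set s]))%E).
      congr fine; apply: measureU => //.
        by rewrite -preimage_itvNyo; exact: measurable_funPTI.
      by apply/seteqP; split=> // t /= [ts st]; move: ts; rewrite st ltxx.
    by rewrite atomless adde0.
  rewrite -lee_fin fineK; last first.
    by rewrite fin_num_measure// -preimage_itvNyo; exact: measurable_funPTI.
  rewrite ltE.
  have mF k : measurable (X @^-1` `]-oo, (s - k.+1%:R^-1)%R]).
    exact: measurable_funPTI.
  apply: (cvge_to_le (nondecreasing_cvg_mu mF (bigcupT_measurable _ mF) _)).
    move=> k k' kk'; apply/subsetPset => t /=.
    rewrite !in_itv/= => /le_trans; apply.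
    by rewrite lerB// lef_pV2 ?posrE// ler_nat.
  apply: nearW => k.
  have : F (s - k.+1%:R^-1) <= y by apply: A_lt; rewrite ltrBlDr ltrDl.
  by rewrite -lee_fin score_cdfE.
have <- : F s = y by apply/eqP; rewrite eq_le Fs_le.
rewrite score_cdfE; congr (P _); apply/seteqP; split=> t /=; rewrite in_itv/=.
  move=> Ft; apply: ub_le_sup => //=; exact: le_trans Ft _.
exact: score_cdf_nondecreasing.
Unshelve. all: by end_near. Qed.

(** The two laws are compared on the pi-system of open rays below [x]. For [0 < x <= 1],
    [1 - F (X t) < x] is the complement of [F (X t) <= 1 - x], whose probability is known; for other
    [x] the event is empty or full. *)
Lemma prob_score_sf (B : set R) : measurable B ->
  P [set t | B (1 - F (X t))] = uniform_prob (@ltr01 R) B.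
Proof.
have mU : measurable_fun setT (fun t => 1 - F (X t)).
  apply: measurable_funB => //; apply: measurableT_comp => //.
  by apply: nondecreasing_measurable => //; exact: score_cdf_nondecreasing.
(* [uniform_prob] is a measure on [measurableTypeR R], whose display differs
   from the one of [R] although the measurable sets are the same. *)
have mU' : @measurable_fun _ _ T (measurableTypeR R) setT
    (fun t => 1 - F (X t)) by exact: mU.
pose U : {RV P >-> measurableTypeR R} :=
  @mfun_Sub _ _ T (measurableTypeR R) _ (mem_set mU').
have mUlt x : measurable [set t | 1 - F (X t) < x].
  have := mU measurableT _ (measurable_itv `]-oo, x[).
  by rewrite setTI preimage_itvNyo.
change (measurable B -> distribution P U B = uniform_prob (@ltr01 R) B).
move=> mB.
apply: (@measure_unique _ R (measurableTypeR R) (@RGenInftyO.G R)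
  (fun k => `]-oo, k%:R[%classic)) => //.
- exact: RGenInftyO.measurableE.
- move=> _ _ [x ->] [y ->]; exists (Order.min x y).
  by apply/seteqP; split => r /=; rewrite !in_itv/= lt_min => /andP.
- by move=> k; exists k%:R.
- apply/seteqP; split=> // r _; exists (Num.trunc r).+1 => //=.
  by rewrite in_itv/= truncnS_gt.
- move=> _ [x ->].
  transitivity (P [set t | 1 - F (X t) < x]).
    by congr (P _); apply/seteqP; split=> t /=; rewrite in_itv.
  apply: etrans (esym (integral_uniform_pdf 0 1 _)).
  have [x0|x0] := leP x 0.
    rewrite (_ : [set t | _] = set0) ?measure0; last first.
      apply/seteqP; split=> // t /=; rewrite ltNge (le_trans x0)// subr_ge0.
      exact: score_cdf_le1.
    rewrite (_ : _ `&` _ = set0) ?integral_set0//.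
    apply/seteqP; split=> // r /=; rewrite !in_itv/= => -[rx /andP[r0 _]].
    by move: (lt_le_trans rx x0); rewrite ltNge r0.
  have [x1|x1] := ltP 1 x.
    rewrite (_ : [set t | _] = setT) ?probability_setT; last first.
      apply/seteqP; split=> // t _ /=; rewrite (le_lt_trans _ x1)//.
      by rewrite lerBlDr lerDl score_cdf_ge0.
    rewrite -integral_uniform_pdf integral_uniform_pdf1//.
    move=> r /=; rewrite !in_itv/= => /andP[_ r1]; exact: le_lt_trans x1.
  rewrite (_ : [set t | _] = ~` [set t | F (X t) <= 1 - x]); last first.
    apply/seteqP; split=> t /=; rewrite ltrBlDr -ltrBlDl.
      by rewrite ltNge => /negP.
    by move=> /negP; rewrite -ltNge.
  rewrite probability_setC; last first.
    have := measurableC (mUlt x); congr measurable.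
    by apply/seteqP; split=> t /=; rewrite ltrBlDr -ltrBlDl leNgt => /negP.
  rewrite prob_score_cdf_le; last by rewrite subr_ge0 x1 ltrBlDr ltrDl.
  rewrite -EFinB subKr (eq_integral (fun=> 1%:E)); last first.
    move=> r; rewrite inE/= !in_itv/= => -[_ r01].
    by rewrite /uniform_pdf r01 subr0 invr1.
  rewrite integral_cst//=; last exact: measurableI.
  rewrite mul1e (_ : _ `&` _ = `[0%R, x[%classic); last first.
    apply/seteqP; split=> r /=; rewrite !in_itv/=.
      by move=> [-> /andP[-> _]].
    by move=> /andP[-> rx]; rewrite rx (ltW (lt_le_trans rx x1)).
  by rewrite lebesgue_measure_itv/= lte_fin x0 sube0.
- move=> k; rewrite -ge0_fin_numE// fin_num_measure//.
Qed.

End probability_integral_transform.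

(** * Conditional joint law of the conformal p-values *)

Lemma measurable_fun_geq_count_eq d (T : measurableType d) (R : realType) (n : nat)
    (s : nat -> T -> R) (x : T -> R) (l : nat) :
  (forall j, (j < n)%N -> measurable_fun setT (s j)) ->
  measurable_fun setT x ->
  measurable_fun setT (fun t => (geq_count n (s^~ t) (x t)).+1 == l).
Proof.
move=> ms mx; apply: measurable_fun_eqn; last exact: measurable_cst.
have -> : (fun t => (geq_count n (s^~ t) (x t)).+1) =
    (fun t => (1%N + geq_count n (s^~ t) (x t))%N) by [].
apply: measurable_fun_addn; first exact: measurable_cst.
elim: n ms => [|n IH] ms.
  have -> : (fun t => geq_count 0 (s^~ t) (x t)) = cst 0%N.
    by apply/funext => t; rewrite /geq_count big_ord0.
  exact: measurable_cst.
have -> : (fun t => geq_count n.+1 (s^~ t) (x t)) =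
    (fun t => (geq_count n (s^~ t) (x t) + (x t <= s n t)%R)%N).
  by apply/funext => t; rewrite /geq_count big_ord_recr.
apply: measurable_fun_addn; first by apply: IH => j jn; exact/ms/ltnW.
apply: (@measurableT_comp _ _ _ _ _ _ nat_of_bool); first by [].
by apply: measurable_fun_ler => //; exact: ms.
Qed.

Lemma measurable_bool_natr d (T : measurableType d) (R : realType)
    (b : T -> bool) : measurable_fun setT b ->
  measurable_fun setT (fun t => (b t)%:R : R).
Proof.
by move=> mb; apply: (@measurableT_comp _ _ _ _ _ _ (fun b : bool => b%:R : R)).
Qed.

Section conformal.
Context d (T : measurableType d) (R : realType) (P : probability T R).
Variables (S : nat -> T -> R) (n m : nat).
Hypothesis mS : forall i, (i < n + m)%N -> measurable_fun setT (S i).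
Hypothesis indepS : indep_family P (fun i : 'I_(n + m) => S i).
Hypothesis identS : forall i, (i < n + m)%N -> forall B : set R, measurable B ->
  P (S i @^-1` B) = P (S 0%N @^-1` B).
Hypothesis nm0 : (0 < n + m)%N.

(** This is [T] equipped only with the sigma-algebra of the first [k] scores; measurability on it
    expresses dependence on those scores alone. *)
Local Notation calibT k := (g_sigma_algebraType (calib_gen S k)).
Local Notation U t := (fun j => 1 - score_cdf P (S 0%N) (S j t)).

Let X0 : {RV P >-> R} := mfun_Sub (mem_set (mS nm0)).

Lemma calib_gen_mono k k' : (k <= k')%N ->
  <<s calib_gen S k >> `<=` <<s calib_gen S k' >>.
Proof.
move=> kk'; apply: sub_sigma_algebra2 => A [j jk AB].
by exists j => //; exact: leq_trans kk'.
Qed.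

Lemma measurable_score_calib j k : (j < k)%N ->
  measurable_fun setT (S j : calibT k -> R).
Proof.
move=> jk _ B mB; rewrite setTI; apply: sub_sigma_algebra.
by exists j => //; exists B.
Qed.

Lemma measurable_calib_mono k k' (g : T -> R) : (k <= k')%N ->
  measurable_fun setT (g : calibT k -> R) ->
  measurable_fun setT (g : calibT k' -> R).
Proof.
by move=> kk' mg _ B mB; apply: (calib_gen_mono kk'); exact: mg.
Qed.

Lemma prob_score_PU t l k : (k < n + m)%N ->
  P (S k @^-1` [set x | (geq_count n (S^~ t) x).+1 = l]) = (PU n (U t) l)%:E.
Proof.
move=> kN; rewrite identS//.
  have -> : U t = fun j => 1 - fine (distribution P X0 `]-oo, S j t]%classic).
    by apply/funext => j; congr (1 - fine _).
  exact: (prob_geq_countE (distribution P X0) n (S^~ t) l).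
exact: measurable_geq_count_eq.
Qed.

Lemma PU_ge0 t l : 0 <= PU n (U t) l.
Proof. by rewrite -lee_fin -(prob_score_PU t l nm0). Qed.

(** The value is the measure of a section of a measurable set in [calibT n * R], so it depends
    measurably on the base point; the sorting inside [PU] never has to be examined. *)
Lemma measurable_PU_calib l :
  measurable_fun setT (fun t : calibT n => PU n (U t) l).
Proof.
pose A : set (calibT n * R) :=
  [set z | (geq_count n (S^~ z.1) z.2).+1 == l].
have mA : measurable A.
  have := @measurable_fun_geq_count_eq _ (calibT n * R)%type R n
    (fun j z => S j z.1) snd l _ measurable_snd measurableT [set true] I.
  rewrite setTI; apply => j jn.
  exact: (measurableT_comp (measurable_score_calib jn) measurable_fst).
apply/measurable_EFinP.
apply: eq_measurable_fun (measurable_fun_xsection (distribution P X0) mA).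
move=> t _ /=; rewrite -(prob_score_PU t l nm0) xsectionE.
by congr (P _); apply/seteqP; split => x /= /eqP.
Qed.

(* The weight [w] may depend on the calibration scores and on the test scores
   before [S k]; [S k] alone is integrated out. *)
Lemma integral_test_point (k l : nat) (w : T -> R) : (n <= k < n + m)%N ->
  (forall t, 0 <= w t) -> measurable_fun setT (w : calibT k -> R) ->
  (\int[P]_t (w t * ((geq_count n (S^~ t) (S k t)).+1 == l)%:R)%:E =
   \int[P]_t (w t * PU n (U t) l)%:E)%E.
Proof.
move=> /andP[nk kN] w0 mw.
(* The whole past of [S k] is encoded as one random element, the identity into [calibT k]. *)
have mY : measurable_fun setT (idfun : T -> calibT k).
  move=> _ B mB; rewrite setTI; exact: (calib_gen_measurable mS (ltnW kN)).
pose Y : {mfun T >-> calibT k} := mfun_Sub (mem_set mY).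
pose Xk : {mfun T >-> R} := mfun_Sub (mem_set (mS kN)).
pose hit (z : calibT k * R) := (geq_count n (S^~ z.1) z.2).+1 == l.
pose f (z : calibT k * R) := (w z.1 * (hit z)%:R)%:E.
have mhit : measurable_fun setT hit.
  apply: (@measurable_fun_geq_count_eq _ (calibT k * R)%type R n
    (fun j z => S j z.1) snd l _ measurable_snd) => j jn.
  apply: measurableT_comp measurable_fst.
  exact: (measurable_score_calib (leq_trans jn nk)).
have mf : measurable_fun setT f.
  apply/measurable_EFinP; apply: measurable_funM.
    exact: (measurableT_comp mw measurable_fst).
  exact: measurable_bool_natr.
have f0 z : (0 <= f z)%E by rewrite lee_fin mulr_ge0.
have := @ge0_integral_indep _ _ _ T (calibT k) R R P Y Xk f _ mf f0.
move=> -> //; last by move=> A C mA mC; exact: (indep_calib mS indepS).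
apply: eq_integral => t _.
pose H := [set x | (geq_count n (S^~ t) x).+1 = l].
have mH : measurable H by exact: measurable_geq_count_eq.
rewrite EFinM -(prob_score_PU t l kN).
transitivity (\int[distribution P Xk]_x ((w t)%:E * (\1_H x)%:E))%E.
  apply: eq_integral => x _; rewrite /f EFinM indicE (_ : hit _ = (x \in H))//.
  by apply/idP/idP; rewrite inE => /eqP.
rewrite ge0_integralZl_EFin//.
  by rewrite integral_indic// setIT.
exact/measurable_EFinP/measurable_indic.
Qed.

(** Induction on [k] with [g] arbitrary: integrating out the last test point leaves a factor [PU]
    that depends only on the calibration scores, so it can be absorbed into [g]. *)
Lemma integral_test_points k (l : nat -> nat) (g : T -> R) : (k <= m)%N ->
  (forall t, 0 <= g t) -> measurable_fun setT (g : calibT n -> R) ->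
  (\int[P]_t (g t * \prod_(i < k)
      ((geq_count n (S^~ t) (S (n + i)%N t)).+1 == l i)%:R)%:E =
   \int[P]_t (g t * \prod_(i < k) PU n (U t) (l i))%:E)%E.
Proof.
elim: k g => [|k IH] g km g0 mg.
  by apply: eq_integral => t _; rewrite !big_ord0.
under eq_integral => t _ do rewrite big_ord_recr/= mulrA.
rewrite (@integral_test_point _ (l k) (fun t => g t * \prod_(i < k)
      ((geq_count n (S^~ t) (S (n + i)%N t)).+1 == l i)%:R)).
- under eq_integral => t _ do rewrite mulrAC.
  rewrite (IH (fun t => g t * PU n (U t) (l k)) (ltnW km)).
  + by apply: eq_integral => t _; rewrite big_ord_recr/= mulrAC mulrA.
  + by move=> t; rewrite mulr_ge0// PU_ge0.
  + by apply: measurable_funM => //; exact: measurable_PU_calib.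
- by rewrite leq_addr ltn_add2l.
- by move=> t; rewrite mulr_ge0// prodr_ge0.
- apply: measurable_funM; first exact: (measurable_calib_mono (leq_addr _ _) mg).
  apply: measurable_prod => i _; apply: measurable_bool_natr.
  apply: (@measurable_fun_geq_count_eq _ (calibT (n + k)) R n S (S (n + i)%N)).
    by move=> j jn; apply: measurable_score_calib; rewrite ltn_addr.
  by apply: measurable_score_calib; rewrite ltn_add2l.
Qed.

Lemma conf_pvalue_eq i t l :
  (conf_pvalue n S i t = l%:R / n.+1%:R) <->
  (geq_count n (S^~ t) (S (n + i)%N t)).+1 = l.
Proof.
have -> : conf_pvalue n S i t =
    (geq_count n (S^~ t) (S (n + i)%N t)).+1%:R / n.+1%:R.
  by rewrite /conf_pvalue; congr (_ / _); rewrite -nat1r natr_sum.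
split=> [|->//].
have n0 : n.+1%:R^-1 != 0 :> R by rewrite invr_eq0.
by move/(mulIf n0)/eqP; rewrite eqr_nat => /eqP.
Qed.

(** This is the defining identity of a conditional probability, tested on each calibration event
    [E]; it follows by taking the indicator of [E] as the weight [g]. *)
Lemma conf_pvalues_cond_iid E (l : nat -> nat) : calib_events n S E ->
  P (E `&` [set t | forall i : 'I_m,
        conf_pvalue n S i t = (l i)%:R / n.+1%:R]) =
  (\int[P]_(t in E) (\prod_(i < m) PU n (U t) (l i))%:E)%E.
Proof.
move=> sE; have mE : measurable E.
  by apply: (calib_gen_measurable mS) sE; exact: leq_addr.
set H := [set t | _].
have HE : H = \bigcap_(i in [set: 'I_m])
    [set t | (geq_count n (S^~ t) (S (n + i)%N t)).+1 == l i].
  apply/seteqP; split=> t /= h i.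
    by move=> _ /=; apply/eqP/conf_pvalue_eq.
  by apply/conf_pvalue_eq/eqP; exact: h.
have mH : measurable H.
  rewrite HE; apply: fin_bigcap_measurable => // i _.
  have := @measurable_fun_geq_count_eq _ T R n S (S (n + i)%N) (l i) _ _
    measurableT [set true] I.
  rewrite setTI; apply => [j jn|]; apply: mS; first exact: ltn_addr.
  by rewrite ltn_add2l.
have mg : measurable_fun setT (\1_E : calibT n -> R).
  exact: (@measurable_indic _ (calibT n) R setT E sE).
have indic_ge0 t : 0 <= \1_E t :> R by rewrite indicE.
have := integral_test_points l (leqnn m) indic_ge0 mg.
have -> : (\int[P]_t (\1_E t * \prod_(i < m)
    ((geq_count n (S^~ t) (S (n + i)%N t)).+1 == l i)%:R)%:E)%E =
    (\int[P]_t (\1_(E `&` H) t)%:E)%E.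
  (* The product of the 0-1 factors is the indicator of [H]: all are 1 on [H], and outside [H] at
     least one vanishes. *)
  apply: eq_integral => t _; rewrite indicI/=; congr ((_ * _)%:E).
  rewrite indicE; have [tH|tH] := boolP (t \in H).
    rewrite big1// => i _; move: tH; rewrite HE inE => /(_ i I) /= ->//.
  have [i hi] : exists i : 'I_m,
      ~~ ((geq_count n (S^~ t) (S (n + i)%N t)).+1 == l i).
    apply/existsP; rewrite -negb_forall; apply: contra tH => /forallP h.
    by rewrite HE inE => i _ /=.
  by rewrite (bigD1 i)//= (negbTE hi) mul0r.
rewrite integral_indic//; last exact: measurableI.
rewrite setIT => ->; rewrite [RHS]integral_mkcond; apply: eq_integral => t _.
by rewrite patchE indicE; case: ifP => _; rewrite ?mul1r ?mul0r.
Qed.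

End conformal.

(** * Absence of atoms, and the conclusion *)

Lemma iid_no_ties_atomless d (T : measurableType d) (R : realType)
    (P : probability T R) (S : nat -> T -> R) (N : nat) (x : R) : (1 < N)%N ->
  (forall i, (i < N)%N -> measurable_fun setT (S i)) ->
  indep_family P (fun i : 'I_N => S i) ->
  (forall B : set R, measurable B -> P (S 1%N @^-1` B) = P (S 0%N @^-1` B)) ->
  {ae P, forall t, S 0%N t <> S 1%N t} ->
  P (S 0%N @^-1` [set x]) = 0%E.
Proof.
move=> N1 mS indepS identS [A [mA PA0 subA]].
have mSx i : (i < N)%N -> measurable (S i @^-1` [set x]).
  by move=> iN; rewrite -[X in measurable X]setTI; exact: (mS _ iN).
have : P (\bigcap_(i < 2) S i @^-1` [set x]) = 0%E.
  apply: (subset_measure0 (mu := P) _ mA _ PA0).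
    apply: bigcap_measurableType => i /= i2.
    exact/mSx/(leq_trans i2).
  by move=> t /= h; apply: subA => /=; rewrite (h 0%N)// (h 1%N).
rewrite (indep_family_prefix indepS (B := fun=> [set x]))//.
rewrite !big_ord_recr big_ord0/= mul1e identS//.
by move=> /eqP; rewrite mule_eq0 orbb => /eqP.
Qed.

Unset Implicit Arguments.

Theorem proposition1 (d : measure_display) (T : measurableType d)
  (R : realType) (P : probability T R) (n m : nat)
  (S : nat -> T -> R) :
  (1 <= n)%N -> (1 <= m)%N ->
  (forall i, (i < n + m)%N -> measurable_fun setT (S i)) ->
  (* i.i.d. *)
  indep_family P (fun i : 'I_(n + m) => S i) ->
  (forall i, (i < n + m)%N -> forall B : set R, measurable B ->
     P (S i @^-1` B) = P (S 0%N @^-1` B)) ->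
  (* almost surely no ties *)
  (forall i j, (i < n + m)%N -> (j < n + m)%N -> i <> j ->
     {ae P, forall t, S i t <> S j t}) ->
  let U := fun (i : nat) (t : T) => 1 - score_cdf P (S 0%N) (S i t) in
  (* conditionally on D_cal, p_1, ..., p_m are i.i.d. with law P^U *)
  (forall E, calib_events n S E ->
     forall l : 'I_m -> nat,
       P (E `&` [set t | forall i : 'I_m,
                   conf_pvalue n S i t = (l i)%:R / n.+1%:R]) =
       (\int[P]_(t in E) (\prod_(i < m) PU n (fun j => U j t) (l i))%:E)%E)
  /\
  (* U_1, ..., U_n are i.i.d. Unif[0,1] *)
  (indep_family P (fun i : 'I_n => U i) /\
   forall i, (i < n)%N -> forall B : set R, measurable B ->
     P (U i @^-1` B) = uniform_prob (@ltr01 R) B).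
Proof.
move=> n0 m0 mS indepS identS noties U.
have nm1 : (1 < n + m)%N by rewrite -(addn1 1) leq_add.
have nm0 : (0 < n + m)%N by exact: ltnW.
split.
  move=> E sE l.
  (* Writing [m] as a successor makes [inord] available, which extends [l] from ['I_m] to all of
     [nat]. *)
  case: m m0 l mS indepS identS {noties} nm1 nm0 => //.
  move=> m' _ l mS indepS identS _ nm0.
  have := conf_pvalues_cond_iid mS indepS identS nm0 (fun i => l (inord i)) sE.
  under eq_integral => t _ do under eq_bigr => i _ do rewrite inord_val.
  move=> <-; congr (P (_ `&` _)).
  by apply/seteqP; split => t /= h i; have := h i; rewrite inord_val.
pose X0 : {RV P >-> R} := mfun_Sub (mem_set (mS _ nm0)).
have atomless x : P (X0 @^-1` [set x]) = 0%E.
  change (P (S 0%N @^-1` [set x]) = 0%E).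
  apply: (iid_no_ties_atomless x nm1 mS indepS) => [B mB|]; first exact: identS.
  exact: noties.
have mphi : measurable_fun setT (fun x => 1 - score_cdf P (S 0%N) x).
  apply: measurable_funB => //.
  by apply: nondecreasing_measurable => //; exact: (score_cdf_nondecreasing X0).
have mpre B : measurable B ->
    measurable ((fun x => 1 - score_cdf P (S 0%N) x) @^-1` B).
  by move=> mB; rewrite -[X in measurable X]setTI; exact: mphi.
split.
  case: n n0 mS indepS {identS noties nm1 nm0 X0 atomless} => //.
  move=> n' _ mS indepS B mB.
  (* Each [U i] is the same measurable function of [S i], so pulling [B i] back along it reduces
     independence to that of the first [n] scores. *)
  pose B' i := (fun x => 1 - score_cdf P (S 0%N) x) @^-1` B (inord i).
  have mB' i : measurable (B' i) by exact: mpre.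
  have := indep_family_prefix indepS (leq_addr _ _) mB'.
  under eq_bigr => i _ do rewrite /B' inord_val.
  move=> <-; congr (P _); apply/seteqP; split=> t /= h i.
    move=> /= ik; have := h (Ordinal ik) I.
    rewrite /B'/= (_ : inord i = Ordinal ik)//.
    by apply/val_inj; rewrite /= inordK.
  by move=> _; have := h i (ltn_ord i); rewrite /B'/= inord_val.
move=> i iN B mB.
(* Uniformity is known for the transform of [S 0]; equality in law carries it over to [S i]. *)
rewrite -(prob_score_sf atomless)//.
exact: (identS _ (ltn_addr m iN) _ (mpre _ mB)).
Qed.
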